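(* Let $\mathcal{C}$ be a small category with finite limits, equipped with an admissible class $\mathcal{M}$, and let $M$ be the associated presheaf. Consider the arrows $\mu_M:\Omega\to\Omega^M$ and $\exists_M:\Omega^M\to\Omega$ in $\widehat{\mathcal{C}}$. Then the composite $\exists_M\circ\mu_M:\Omega\to\Omega$ is a (Lawvere--Tierney) topology on $\widehat{\mathcal{C}}$, and it is given by $$(\exists_M\circ\mu_M)_C(S_C)=\{f\mid C_f=C,\ \exists g\in\mathcal{M}/D_f;\ fg\in S_C\}$$ for any $C\in\mathcal{C}$ and $S_C\in\Omega(C)$.
   Context: $\widehat{\mathcal{C}}$ is the category of presheaves of sets on $\mathcal{C}$, with subobject classifier $\Omega$: $\Omega(C)$ is the set of sieves on $C$. For an arrow $f$, $D_f$ is its domain and $C_f$ its codomain. $\mathbf{y}$ is the Yoneda functor. An admissible class $\mathcal{M}$ on $\mathcal{C}$ is a family of subobjects (monics) of $\mathcal{C}$ which contains all identities, is closed under composition, and is closed under pullback along arbitrary arrows. It yields a subpresheaf $M$ of $\mathrm{Sub}_{\mathcal{C}}(-):\mathcal{C}^{\mathrm{op}}\to\mathbf{Sets}$ by $M(C)=\mathcal{M}/C$, the set of subobjects of $C$ in $\mathcal{M}$, with action of arrows $h$ by pullback $h^{-1}$. $\Omega^M(C)$ is the set of subpresheaves of $\mathbf{y}(C)\times M$. The arrow $\mu_M$ is given by $$((\mu_M)_C(S_C))(D)=\{(f,g)\in\mathbf{y}(C)(D)\times M(D)\mid fg\in S_C\}.$$ The internal existential quantifier $\exists_M:\Omega^M\to\Omega$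 is given by $(\exists_M)_C(U)=\{f\mid C_f=C,\ \exists x\in M(D_f);\ (f,x)\in U(D_f)\}$ for a subpresheaf $U\subseteq\mathbf{y}(C)\times M$. A topology on $\widehat{\mathcal{C}}$ is a morphism $j:\Omega\to\Omega$ with $j\circ\mathrm{true}=\mathrm{true}$, $j\circ j=j$, $j\circ\wedge=\wedge\circ(j\times j)$. *)

(* Defs.v *)
From mathcomp Require Import all_boot.
From mathcomp Require Import boolp classical_sets functions cardinality.

Set Implicit Arguments.
Unset Strict Implicit.
Unset Printing Implicit Defensive.

Local Obligation Tactic := idtac.
Local Open Scope classical_set_scope.

Record Category := MkCategory {
  Obj :> Type;
  Hom : Obj -> Obj -> Type;
  idc : forall A, Hom A A;
  hcomp : forall A B D, Hom B D -> Hom A B -> Hom A D;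
  hcomp1f : forall A B (f : Hom A B), hcomp (idc B) f = f;
  hcompf1 : forall A B (f : Hom A B), hcomp f (idc A) = f;
  hcompA : forall A B D E (f : Hom D E) (g : Hom B D) (h : Hom A B),
    hcomp f (hcomp g h) = hcomp (hcomp f g) h }.

Arguments Hom {_} _ _.
Arguments idc {_} _.
Arguments hcomp {_ _ _ _} _ _.

(* [f ∘ g] is "g first, then f", the composite written fg in juxtaposition. *)
Notation "f ∘ g" := (hcomp f g) (at level 40, left associativity).

Record Functor (J C : Category) := MkFunctor {
  fobj :> J -> C;
  fmap : forall i j, Hom i j -> Hom (fobj i) (fobj j);
  fmap1 : forall i, fmap (idc i) = idc (fobj i);
  fmapM : forall i j k (u : Hom j k) (v : Hom i j),
    fmap (u ∘ v) = fmap u ∘ fmap v }.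

Arguments fmap {_ _} _ {_ _} _.

Definition finite_category (J : Category) : Prop :=
  finite_set [set: Obj J] /\ forall i j : J, finite_set [set: Hom i j].

Record Cone (J C : Category) (F : Functor J C) := MkCone {
  apex : C;
  leg : forall i : J, Hom apex (F i);
  leg_nat : forall (i j : J) (u : Hom i j), fmap F u ∘ leg i = leg j }.

Arguments leg {_ _ _} _ _.

Definition is_limit (J C : Category) (F : Functor J C) (L : Cone F) : Prop :=
  forall K : Cone F, exists! w : Hom (apex K) (apex L),
    forall i, leg L i ∘ w = leg K i.

Definition has_finite_limits (C : Category) : Prop :=
  forall J : Category, finite_category J ->
  forall F : Functor J C, exists L : Cone F, is_limit L.

Definition mono (C : Category) (A B : C) (f : Hom A B) : Prop :=
  forall E (u v : Hom E A), f ∘ u = f ∘ v -> u = v.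

(*
        q
    P -----> A
    |        |
   p|        |m
    v        v
    B -----> D
        h
*)
Definition is_pullback (C : Category) (A B D P : C)
    (m : Hom A D) (h : Hom B D) (q : Hom P A) (p : Hom P B) : Prop :=
  m ∘ q = h ∘ p /\
  forall E (u : Hom E A) (v : Hom E B), m ∘ u = h ∘ v ->
    exists! w : Hom E P, q ∘ w = u /\ p ∘ w = v.

Record mono_over (C : Category) (c : C) := MonoOver {
  mdom : C;
  marr :> Hom mdom c;
  marrP : mono marr }.

Definition mono_iso (C : Category) (c : C) (m n : mono_over c) : Prop :=
  exists (u : Hom (mdom m) (mdom n)) (v : Hom (mdom n) (mdom m)),
    [/\ v ∘ u = idc _, u ∘ v = idc _ & n ∘ u = m].

Record subobj (C : Category) (c : C) := Subobj {
  sub_cls :> mono_over c -> Prop;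
  sub_clsP : exists m, sub_cls = mono_iso m }.

Record Presheaf (C : Category) := MkPresheaf {
  pobj :> C -> Type;
  pact : forall c d, Hom d c -> pobj c -> pobj d;
  pact1 : forall c (x : pobj c), pact (idc c) x = x;
  pactM : forall c d e (f : Hom d c) (g : Hom e d) (x : pobj c),
    pact (f ∘ g) x = pact g (pact f x) }.

Arguments pact {_} _ {_ _} _ _.

Record NatTrans (C : Category) (F G : Presheaf C) := MkNatTrans {
  ntapp :> forall c : C, F c -> G c;
  nt_nat : forall (c d : C) (h : Hom d c) (x : F c),
    ntapp (pact F h x) = pact G h (ntapp x) }.

Arguments ntapp {_ _ _} _ _ _.

Program Definition nt_comp (C : Category) (F G H : Presheaf C)
    (s : NatTrans G H) (t : NatTrans F G) : NatTrans F H :=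
  {| ntapp := fun c x => s c (t c x) |}.
Next Obligation. by move=> *; rewrite /= !nt_nat. Qed.

Program Definition terminalP (C : Category) : Presheaf C :=
  {| pobj := fun _ => unit; pact := fun _ _ _ x => x |}.
Solve All Obligations with done.

Program Definition prodP (C : Category) (F G : Presheaf C) : Presheaf C :=
  {| pobj := fun c => (F c * G c)%type;
     pact := fun c d h x => (pact F h x.1, pact G h x.2) |}.
Next Obligation. by move=> C F G c [x y]; rewrite /= !pact1. Qed.
Next Obligation. by move=> *; rewrite /= !pactM. Qed.

Program Definition prod_map (C : Category) (F F' G G' : Presheaf C)
    (s : NatTrans F F') (t : NatTrans G G') :
    NatTrans (prodP F G) (prodP F' G') :=
  {| ntapp := fun c x => (s c x.1, t c x.2) |}.
Next Obligation. by move=> *; rewrite /= !nt_nat. Qed.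

Program Definition yoneda (C : Category) (c : C) : Presheaf C :=
  {| pobj := fun d => Hom d c; pact := fun d e h f => f ∘ h |}.
Next Obligation. by move=> *; rewrite /= hcompf1. Qed.
Next Obligation. by move=> *; rewrite /= hcompA. Qed.

Record Subpresheaf (C : Category) (F : Presheaf C) := MkSubpresheaf {
  spset :> forall d : C, set (F d);
  spP : forall (d e : C) (h : Hom e d) (x : F d),
    @spset d x -> @spset e (pact F h x) }.

Arguments spset {_ _} _ _ _.

Lemma subpresheaf_eq (C : Category) (F : Presheaf C) (U V : Subpresheaf F) :
  (forall d x, U d x <-> V d x) -> U = V.
Proof.
case: U V => [U hU] [V hV] /= UV.
have E : U = V by apply: functional_extensionality_dep => d; apply/predeqP.
by case: _ / E in hV UV *; congr MkSubpresheaf.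
Qed.

(* A subpresheaf regarded as a presheaf in its own right. *)
Program Definition sub_presheaf (C : Category) (F : Presheaf C)
    (U : Subpresheaf F) : Presheaf C :=
  {| pobj := fun d => {x : F d | U d x};
     pact := fun d e h x => exist _ (pact F h (sval x)) (spP h (svalP x)) |}.
Next Obligation. by move=> C F U c [x ?]; apply: eq_exist; rewrite /= pact1. Qed.
Next Obligation. by move=> *; apply: eq_exist; rewrite /= pactM. Qed.

Record sieve (C : Category) (c : C) := MkSieve {
  sv :> forall d : C, set (Hom d c);
  svP : forall (d e : C) (f : Hom d c) (g : Hom e d), sv f -> sv (f ∘ g) }.

Arguments sv {_ _} _ {_} _.

Lemma sieve_eq (C : Category) (c : C) (S T : sieve c) :
  (forall d (f : Hom d c), sv S f <-> sv T f) -> S = T.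
Proof.
case: S T => [U hU] [V hV] /= UV.
have E : U = V by apply: functional_extensionality_dep => d; apply/predeqP.
by case: _ / E in hV UV *; congr MkSieve.
Qed.

Program Definition sieve_pull (C : Category) (c d : C) (h : Hom d c)
    (S : sieve c) : sieve d :=
  {| sv := fun e => [set f : Hom e d | sv S (h ∘ f)] |}.
Next Obligation. by move=> *; rewrite /= hcompA; apply: svP. Qed.

Program Definition Omega (C : Category) : Presheaf C :=
  {| pobj := fun c => sieve c;
     pact := fun c d h S => sieve_pull h S |}.
Next Obligation.
by move=> C c x; apply: sieve_eq => d f /=; rewrite hcomp1f.
Qed.
Next Obligation.
by move=> C c d e f g x; apply: sieve_eq => a k /=; rewrite hcompA.
Qed.

Definition max_sieve (C : Category) (c : C) : sieve c :=
  {| sv := fun d => [set: Hom d c]; svP := fun _ _ _ _ _ => I |}.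

Program Definition trueP (C : Category) : NatTrans (terminalP C) (Omega C) :=
  {| ntapp := fun c _ => max_sieve c |}.
Next Obligation. by move=> *; apply: sieve_eq. Qed.

Program Definition sieve_meet (C : Category) (c : C) (S T : sieve c) : sieve c :=
  {| sv := fun d => [set f : Hom d c | sv S f /\ sv T f] |}.
Next Obligation. by move=> C c S T d e f g [? ?]; split; apply: svP. Qed.

Program Definition meetP (C : Category) :
    NatTrans (prodP (Omega C) (Omega C)) (Omega C) :=
  {| ntapp := fun c ST => sieve_meet ST.1 ST.2 |}.
Next Obligation. by move=> *; apply: sieve_eq. Qed.

Record is_topology (C : Category) (j : NatTrans (Omega C) (Omega C)) : Prop :=
  IsTopology {
  topology_true : nt_comp j (trueP C) = trueP C;
  topology_idem : nt_comp j j = j;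
  topology_meet : nt_comp j (meetP C) = nt_comp (meetP C) (prod_map j j) }.

Program Definition power_act (C : Category) (X : Presheaf C) (c d : C)
    (h : Hom d c) (U : Subpresheaf (prodP (yoneda c) X)) :
    Subpresheaf (prodP (yoneda d) X) :=
  {| spset := fun e => [set p : prodP (yoneda d) X e | U e (h ∘ p.1, p.2)] |}.
Next Obligation.
move=> C X c d h U e a k [f x] /= /(spP k) /=.
by rewrite hcompA.
Qed.

(* The exponential of [Omega] by [X]; [h : d -> c] acts by inverse image along
   the map y(d) x X -> y(c) x X induced by [h]. *)
Program Definition power (C : Category) (X : Presheaf C) : Presheaf C :=
  {| pobj := fun c => Subpresheaf (prodP (yoneda c) X);
     pact := fun c d h U => power_act h U |}.
Next Obligation.
by move=> C X c U; apply: subpresheaf_eq => d [f x] /=; rewrite hcomp1f.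
Qed.
Next Obligation.
by move=> C X c d e f g U; apply: subpresheaf_eq => a [k x] /=; rewrite hcompA.
Qed.

Program Definition ex_sieve (C : Category) (X : Presheaf C) (c : C)
    (U : Subpresheaf (prodP (yoneda c) X)) : sieve c :=
  {| sv := fun d => [set f : Hom d c | exists x : X d, U d (f, x)] |}.
Next Obligation.
by move=> C X c U d e f g [x /(spP g) /= Ux]; exists (pact X g x).
Qed.

Program Definition exists_arrow (C : Category) (X : Presheaf C) :
    NatTrans (power X) (Omega C) :=
  {| ntapp := fun c U => ex_sieve U |}.
Next Obligation. by move=> *; apply: sieve_eq. Qed.

Section Cospan.

Definition cospan_le (a b : option bool) : bool := (a == b) || (b == None).

Program Definition cospan : Category :=
  {| Obj := option bool; Hom := fun a b => is_true (cospan_le a b) |}.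
Next Obligation. by case=> [[]|]. Qed.
Next Obligation. by case=> [[]|] [[]|] [[]|]. Qed.
Next Obligation. by move=> *; apply: bool_irrelevance. Qed.
Next Obligation. by move=> *; apply: bool_irrelevance. Qed.
Next Obligation. by move=> *; apply: bool_irrelevance. Qed.

Lemma finite_cospan : finite_category cospan.
Proof.
split=> [|i j]; first exact: finite_finset.
have [h|nh] := pselect (is_true (cospan_le i j)).
  suff -> : [set: @Hom cospan i j] = [set h] by exact: finite_set1.
  by apply/predeqP => x; split=> // _; apply: bool_irrelevance.
suff -> : [set: @Hom cospan i j] = set0 by exact: finite_set0.
by apply/predeqP => x; split=> // _; apply: nh.
Qed.

Variables (C : Category) (A B D : C) (f : Hom A D) (g : Hom B D).

Definition cospan_obj (a : cospan) : C :=
  match a with None => D | Some true => A | Some false => B end.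

Definition cospan_map (a b : cospan) :
    Hom a b -> Hom (cospan_obj a) (cospan_obj b) :=
  match a, b return @Hom cospan a b -> Hom (cospan_obj a) (cospan_obj b) with
  | Some true, Some true => fun _ => idc A
  | Some true, None => fun _ => f
  | Some false, Some false => fun _ => idc B
  | Some false, None => fun _ => g
  | None, None => fun _ => idc D
  | _, _ => fun h => False_rect _ (notF h)
  end.

Program Definition cospan_functor : Functor cospan C :=
  {| fobj := cospan_obj; fmap := cospan_map |}.
Next Obligation. by case=> [[]|]. Qed.
Next Obligation.
by case=> [[]|] [[]|] [[]|] u v //=; rewrite ?hcomp1f ?hcompf1.
Qed.

Program Definition cospan_cone (E : C) (u : Hom E A) (v : Hom E B)
    (uv : f ∘ u = g ∘ v) : Cone cospan_functor :=
  {| apex := E;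
     leg := fun a => match a return Hom E (cospan_obj a) with
            | None => f ∘ u | Some true => u | Some false => v end |}.
Next Obligation.
by move=> E u v uv [[]|] [[]|] w //=; rewrite ?hcomp1f.
Qed.

Lemma has_pullbacks : has_finite_limits C ->
  exists P (p : Hom P A) (q : Hom P B), is_pullback f g p q.
Proof.
move=> /(_ cospan finite_cospan cospan_functor) [L limL].
have nt : @Hom cospan (Some true) None by [].
have nf : @Hom cospan (Some false) None by [].
have Lt := leg_nat L nt; have Lf := leg_nat L nf.
rewrite /= in Lt Lf.
exists (apex L), (leg L (Some true)), (leg L (Some false)).
split=> [|E u v uv]; first by rewrite Lt Lf.
have [w [wP wU]] := limL (cospan_cone uv).
exists w; split; first by split; [exact: (wP (Some true))|exact: (wP (Some false))].
move=> w' [w't w'f]; apply: wU => -[[]|] //=.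
by rewrite -Lt -hcompA w't.
Qed.

End Cospan.

Section Factors.
Variable C : Category.

Definition factors (c e : C) (k : Hom e c) (m : mono_over c) : Prop :=
  exists w : Hom e (mdom m), m ∘ w = k.

Lemma mono_isoP (c : C) (m n : mono_over c) :
  mono_iso m n <-> forall e (k : Hom e c), factors k m <-> factors k n.
Proof.
split=> [[u [v [vu uv nu]]] e k|mn].
  split=> -[w <-]; first by exists (u ∘ w); rewrite hcompA nu.
  by exists (v ∘ w); rewrite -nu -hcompA (hcompA u) uv hcomp1f.
have [|u nu] := (mn _ m).1; first by exists (idc _); rewrite hcompf1.
have [|v mv] := (mn _ n).2; first by exists (idc _); rewrite hcompf1.
exists u, v; split=> //.
  by apply: (marrP (m := m)); rewrite hcompA mv nu hcompf1.
by apply: (marrP (m := n)); rewrite hcompA nu mv hcompf1.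
Qed.

Lemma pullback_factors (c d : C) (h : Hom d c) (m : mono_over c)
    (n : mono_over d) :
  (exists q, is_pullback m h q n) <->
  forall e (k : Hom e d), factors k n <-> factors (h ∘ k) m.
Proof.
split=> [[q [sq univ]] e k|H].
  split=> [[w <-]|[w mw]]; first by exists (q ∘ w); rewrite !hcompA sq.
  by have [x [[_ nx] _]] := univ _ _ _ mw; exists x.
have [|q mq] := (H _ n).1; first by exists (idc _); rewrite hcompf1.
exists q; split=> // e u v uv.
have [|w nw] := (H _ v).2; first by exists u.
exists w; split; last by move=> w' [_ nw']; apply: (marrP (m := n)); rewrite nw nw'.
by split=> //; apply: (marrP (m := m)); rewrite hcompA mq -hcompA nw.
Qed.

Lemma sub_iso (c : C) (S : subobj c) (m n : mono_over c) :
  S m -> S n <-> mono_iso m n.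
Proof.
have [m0 ->] := sub_clsP S => /= /mono_isoP m0m.
split=> /mono_isoP H; apply/mono_isoP => e k; first by rewrite -m0m.
by rewrite m0m.
Qed.

Lemma sub_inhabited (c : C) (S : subobj c) : exists m, S m.
Proof. by have [m ->] := sub_clsP S; exists m; apply/mono_isoP. Qed.

Lemma subobj_eq (c : C) (S T : subobj c) : (forall m, S m <-> T m) -> S = T.
Proof.
case: S T => [S hS] [T hT] /= /predeqP E.
by case: _ / E in hT *; congr Subobj.
Qed.

Lemma mono_pullback (A B D P : C) (m : Hom A D) (h : Hom B D)
    (q : Hom P A) (p : Hom P B) : mono m -> is_pullback m h q p -> mono p.
Proof.
move=> mm [sq univ] E u v uv.
have [|w [_ wU]] := univ E (q ∘ u) (p ∘ u); first by rewrite !hcompA sq.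
rewrite -(wU u) // -(wU v) //; split=> //.
by apply: mm; rewrite !hcompA sq -!hcompA uv.
Qed.

Definition sub_pull_cls (c d : C) (h : Hom d c) (S : subobj c) :
    mono_over d -> Prop :=
  fun n => exists2 m, S m & exists q, is_pullback m h q n.

Hypothesis HC : has_finite_limits C.

Lemma sub_pullback_ex (c d : C) (h : Hom d c) (m : mono_over c) :
  exists (n : mono_over d) q, is_pullback m h q n.
Proof.
have [P [p [q pb]]] := has_pullbacks m h HC.
by exists (MonoOver (mono_pullback (marrP (m := m)) pb)), p.
Qed.

Lemma sub_pull_clsP (c d : C) (h : Hom d c) (S : subobj c) :
  exists n, sub_pull_cls h S = mono_iso n.
Proof.
have [m Sm] := sub_inhabited S.
have [n /pullback_factors nP] := sub_pullback_ex h m.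
exists n; apply/predeqP => n'; split=> [[m' Sm' /pullback_factors n'P]|].
  move/(sub_iso _ Sm)/mono_isoP: Sm' => mm'.
  by apply/mono_isoP => e k; rewrite nP n'P.
by move=> /mono_isoP nn'; exists m => //; apply/pullback_factors => e k; rewrite -nP nn'.
Qed.

(* The inverse image [h^-1] on subobjects. *)
Definition sub_pull (c d : C) (h : Hom d c) (S : subobj c) : subobj d :=
  Subobj (sub_pull_clsP h S).

Program Definition SubP : Presheaf C :=
  {| pobj := fun c => subobj c; pact := fun c d h S => sub_pull h S |}.
Next Obligation.
move=> c S; apply: subobj_eq => n; split.
  move=> [m Sm /pullback_factors H]; apply/(sub_iso _ Sm)/mono_isoP => e k.
  by rewrite H hcomp1f.
by move=> Sn; exists n => //; apply/pullback_factors => e k; rewrite hcomp1f.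
Qed.
Next Obligation.
move=> c d e f g S; apply: subobj_eq => n; split.
  move=> [m Sm /pullback_factors H].
  have [n' pb] := sub_pullback_ex f m.
  exists n'; first by exists m.
  move/pullback_factors: pb => pb.
  by apply/pullback_factors => a k; rewrite H pb hcompA.
move=> [n' [m Sm /pullback_factors H] /pullback_factors H'].
by exists m => //; apply/pullback_factors => a k; rewrite H' H hcompA.
Qed.

End Factors.

(* The last condition applies to every pullback square, so it makes the class
   invariant under isomorphism over the codomain: membership depends only on
   the subobject that a monic represents. *)
Record AdmissibleClass (C : Category) := MkAdmissible {
  adm :> forall A B : C, set (Hom A B);
  adm_mono : forall A B (m : Hom A B), adm m -> mono m;
  adm_id : forall A : C, adm (idc A);
  adm_comp : forall A B D (m : Hom B D) (n : Hom A B),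
    adm m -> adm n -> adm (m ∘ n);
  adm_pull : forall A B D P (m : Hom A D) (h : Hom B D)
      (q : Hom P A) (p : Hom P B),
    is_pullback m h q p -> adm m -> adm p }.

Arguments adm {_} _ {_ _} _.

Lemma adm_iso (C : Category) (M : AdmissibleClass C) (c : C)
    (m n : mono_over c) : mono_iso m n -> adm M m -> adm M n.
Proof.
move=> /mono_isoP mn.
have [|q pb] := (pullback_factors (idc c) m n).2; last exact: adm_pull pb.
by move=> e k; rewrite hcomp1f -mn.
Qed.

Section AdmissiblePresheaf.
Variables (C : Category) (HC : has_finite_limits C) (M : AdmissibleClass C).

Program Definition adm_sub : Subpresheaf (SubP HC) :=
  {| spset := fun c => [set S : subobj c | exists2 m, S m & adm M m] |}.
Next Obligation.
move=> c d h S [m Sm Mm].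
have [n [q pb]] := sub_pullback_ex HC h m.
exists n; last exact: adm_pull pb Mm.
by exists m => //; exists q.
Qed.

Definition adm_presheaf : Presheaf C := sub_presheaf adm_sub.

End AdmissiblePresheaf.

(* "fg belongs to S" for a subobject g of the domain of f: some monic
   representing g does.  By [comp_inP] the choice is immaterial. *)
Definition comp_in (C : Category) (c d : C) (S : sieve c) (f : Hom d c)
    (g : subobj d) : Prop :=
  exists2 m : mono_over d, g m & sv S (f ∘ m).

Lemma comp_inP (C : Category) (c d : C) (S : sieve c) (f : Hom d c)
    (g : subobj d) (m : mono_over d) :
  g m -> comp_in S f g <-> sv S (f ∘ m).
Proof.
move=> gm; split=> [[n gn Sn]|Sm]; last by exists m.
have [u [v [_ _ <-]]] := (sub_iso n gm).1 gn.
by rewrite hcompA; apply: svP.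
Qed.

Section Mu.
Variables (C : Category) (HC : has_finite_limits C) (M : AdmissibleClass C).

Program Definition mu_sub (c : C) (S : sieve c) :
    Subpresheaf (prodP (yoneda c) (adm_presheaf HC M)) :=
  {| spset := fun d => [set p : prodP (yoneda c) (adm_presheaf HC M) d |
                         comp_in S p.1 (sval p.2)] |}.
Next Obligation.
move=> c S d e h [f [g Mg]] /= [m gm Sm].
have [n [q pb]] := sub_pullback_ex HC h m.
exists n; first by exists m => //; exists q.
by rewrite -hcompA -(proj1 pb) hcompA; apply: svP.
Qed.

Program Definition mu : NatTrans (Omega C) (power (adm_presheaf HC M)) :=
  {| ntapp := fun c S => mu_sub S |}.
Next Obligation.
move=> c d h S; apply: subpresheaf_eq => e [f g].
by split=> -[m gm Sm]; exists m => //; move: Sm; rewrite /= hcompA.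
Qed.

End Mu.

(* Main.v *)
Require Import Defs.
From mathcomp Require Import all_boot.
From mathcomp Require Import boolp classical_sets.

(** An arrow [f] lies in the image
    of a sieve [S] iff [f ∘ m] lies in [S] for some admissible monic [m] into
    the domain of [f].  Preservation of [true], idempotence and preservation of
    meets then come from admissibility of identities, from closure under
    composition, and from closure under intersection (a pullback followed by a
    composition). *)

Set Implicit Arguments.
Unset Strict Implicit.
Unset Printing Implicit Defensive.

Local Open Scope classical_set_scope.

Lemma nat_trans_eq (C : Category) (F G : Presheaf C) (s t : NatTrans F G) :
  (forall c x, s c x = t c x) -> s = t.
Proof.
case: s t => [s hs] [t ht] /= st.
have E : s = t.
  by apply: functional_extensionality_dep => c; apply/funext => x; apply: st.
by case: _ / E in ht st *; congr MkNatTrans; apply: Prop_irrelevance.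
Qed.

(** By [comp_inP] any admissible representative of a subobject can serve as witness; conversely, an
    admissible monic represents its own [mono_iso] class. *)
Lemma exists_mu_adm (C : Category) (HC : has_finite_limits C)
    (M : AdmissibleClass C) (c d : C) (S : sieve c) (f : Hom d c) :
  sv (nt_comp (exists_arrow (adm_presheaf HC M)) (mu HC M) c S) f <->
  exists2 m : mono_over d, adm M m & sv S (f ∘ m).
Proof.
split=> [[[g [m gm Mm]] /= /(comp_inP _ _ gm) Sm]|[m Mm Sm]]; first by exists m.
have mm : mono_iso m m by apply/mono_isoP.
have [g gm] : exists g : subobj d, g m.
  by exists (Subobj (ex_intro _ m (erefl (mono_iso m)))).
have Mg : adm_sub HC M d g by exists m.
by exists (exist _ g Mg); exists m.
Qed.

Theorem theorem3p6 (C : Category) (HC : has_finite_limits C)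
    (M : AdmissibleClass C) :
  is_topology (nt_comp (exists_arrow (adm_presheaf HC M)) (mu HC M)) /\
  forall (c : C) (S : Omega C c) (d : C),
    sv (nt_comp (exists_arrow (adm_presheaf HC M)) (mu HC M) c S) =
    [set f : Hom d c | exists g : adm_presheaf HC M d, comp_in S f (sval g)].
Proof.
(* The explicit formula holds by unfolding definitions. *)
split=> //; set j := nt_comp _ _.
have jP c d (S : sieve c) (f : Hom d c) :
    sv (j c S) f <-> exists2 m : mono_over d, adm M m & sv S (f ∘ m).
  exact: exists_mu_adm.
(* [j] is inflationary, witnessed by the identity; this gives preservation of [true] and half of
   idempotence. *)
have jI c d (S : sieve c) (f : Hom d c) : sv S f -> sv (j c S) f.
  move=> Sf; apply/jP; exists (MonoOver (adm_mono (adm_id M d))).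
    exact: adm_id.
  by rewrite /= hcompf1.
split; apply: nat_trans_eq => c.
- by move=> x; apply: sieve_eq => d f; split=> // _; apply: jI.
- move=> S; apply: sieve_eq => d f; split; last exact: jI.
  move=> /jP[m Mm] /jP[n Mn Smn]; apply/jP.
  exists (MonoOver (adm_mono (adm_comp Mm Mn))); first exact: adm_comp.
  by rewrite /= hcompA.
- move=> [S T]; apply: sieve_eq => d f; split.
    move=> /jP[m Mm [Sm Tm]].
    by split; apply/jP; exists m.
  move=> [/jP[m Mm Sm] /jP[n Mn Tn]]; apply/jP.
  (* The diagonal [n ∘ q = m ∘ p] is the intersection of [m] and [n]; [q] is admissible as a
     pullback of [m]. *)
  have [P [p [q pb]]] := has_pullbacks m n HC.
  have Mnq : adm M (n ∘ q) by apply: adm_comp => //; apply: adm_pull pb Mm.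
  exists (MonoOver (adm_mono Mnq)) => //=; split.
    by rewrite -(proj1 pb) hcompA; apply: svP.
  by rewrite hcompA; apply: svP.
Qed.
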